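(* Let $a,b$ be real numbers with $1<a<b$. Then $$\pi=\frac{2\sqrt{(b^2-a^2)(a^2b^2-1)}}{a^3(b^2-1)}\;\frac{K\!\left(\dfrac{b(a^2-1)}{a(b^2-1)}\right)}{F_D^{(3)}\!\left(\tfrac12;\tfrac12,\tfrac12,\tfrac12;1\,\Big|\,1-a^4,\dfrac{(1-a^4)b^2}{b^2-a^2},\dfrac{a^4-1}{a^2b^2-1}\right)}.$$
   Context: $K(k)=\int_0^1\frac{dx}{\sqrt{(1-x^2)(1-k^2x^2)}}$ is the complete elliptic integral of the first kind, as a function of the modulus $k$. The Lauricella function of $n$ variables is $F_D^{(n)}(\alpha;\beta_1,\dots,\beta_n;\gamma\,|\,x_1,\dots,x_n)=\sum_{m_1,\dots,m_n\ge0}\frac{(\alpha)_{m_1+\cdots+m_n}(\beta_1)_{m_1}\cdots(\beta_n)_{m_n}}{(\gamma)_{m_1+\cdots+m_n}\,m_1!\cdots m_n!}x_1^{m_1}\cdots x_n^{m_n}$ for $|x_j|<1$, with $(x)_k$ the Pochhammer symbol. For $\operatorname{Re}\gamma>\operatorname{Re}\alpha>0$ it equals, and outside the region of convergence is defined by analytic continuation through, $\frac{\Gamma(\gamma)}{\Gamma(\alpha)\Gamma(\gamma-\alpha)}\int_0^1\frac{u^{\alpha-1}(1-u)^{\gamma-\alpha-1}}{(1-x_1u)^{\beta_1}\cdots(1-x_nu)^{\beta_n}}\,du$ (principal branches, $x_j\notin[1,\infty)$). *)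

(* Defs.v *)
From mathcomp Require Import all_boot all_order all_algebra.
From mathcomp Require Import all_classical all_reals all_analysis.

Set Implicit Arguments.
Unset Strict Implicit.
Unset Printing Implicit Defensive.

Import Order.TTheory GRing.Theory Num.Theory.
Import numFieldNormedType.Exports.

Local Open Scope classical_set_scope.
Local Open Scope ring_scope.

(* The argument is the modulus k (not the parameter m = k ^ 2); the integral
   is meaningful for -1 < k < 1. *)
Definition ellipticK (R : realType) (k : R) : R :=
  \int[@lebesgue_measure R]_(x in `]0, 1[)
    (Num.sqrt ((1 - x ^+ 2) * (1 - k ^+ 2 * x ^+ 2)))^-1.

Definition pochhammer (R : realType) (x : R) (k : nat) : R :=
  \prod_(i < k) (x + i%:R).

(* Euler's integral; meaningful for s > 0. *)
Definition Gamma (R : realType) (s : R) : R :=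
  \int[@lebesgue_measure R]_(t in `]0, +oo[) (t `^ (s - 1) * expR (- t)).

Definition lauricella_term (R : realType) (n : nat) (alpha : R)
    (beta : n.-tuple R) (gamma : R) (x : n.-tuple R) (m : 'I_n -> nat) : R :=
  pochhammer alpha (\sum_(j < n) m j)%N
    * (\prod_(j < n) pochhammer (tnth beta j) (m j))
  / (pochhammer gamma (\sum_(j < n) m j)%N * \prod_(j < n) ((m j)`!)%:R)
  * \prod_(j < n) tnth x j ^+ m j.

(* The multiple series over nat^n is absolutely convergent when all |x_j| < 1;
   its sum is taken along the cubes {0, ..., N - 1}^n. *)
Definition lauricella_series (R : realType) (n : nat) (alpha : R)
    (beta : n.-tuple R) (gamma : R) (x : n.-tuple R) : R :=
  limn (fun N : nat => \sum_(m : {ffun 'I_n -> 'I_N})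
    lauricella_term alpha beta gamma x (fun j => m j : nat)).

(* Meaningful for 0 < alpha < gamma and all x_j < 1. The bases 1 - x_j u are
   then positive, so that the real powers below are the principal branches. *)
Definition lauricella_integral (R : realType) (n : nat) (alpha : R)
    (beta : n.-tuple R) (gamma : R) (x : n.-tuple R) : R :=
  Gamma gamma / (Gamma alpha * Gamma (gamma - alpha))
  * \int[@lebesgue_measure R]_(u in `]0, 1[)
      (u `^ (alpha - 1) * (1 - u) `^ (gamma - alpha - 1)
       / \prod_(j < n) (1 - tnth x j * u) `^ (tnth beta j)).

(* Real slice of the Lauricella function: the series in its region of
   convergence, and its analytic continuation to x_j < 1 elsewhere. The values
   outside the polydisc are meaningful for 0 < alpha < gamma. *)
Definition lauricellaFD (R : realType) (n : nat) (alpha : R)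
    (beta : n.-tuple R) (gamma : R) (x : n.-tuple R) : R :=
  if [forall j, `|tnth x j| < 1] then lauricella_series alpha beta gamma x
  else lauricella_integral alpha beta gamma x.

(* Main.v *)
Require Import Defs.
From mathcomp Require Import all_boot all_order all_algebra.
From mathcomp Require Import all_classical all_reals all_analysis.
From mathcomp Require Import measurable_realfun ring lra.
Import Order.TTheory GRing.Theory Num.Theory.
Import numFieldNormedType.Exports.
Set Implicit Arguments.
Unset Strict Implicit.
Unset Printing Implicit Defensive.
Local Open Scope ring_scope.
Local Open Scope classical_set_scope.

(** For alpha = beta_j = 1/2 and gamma = 1 the constant in Euler's formula is
    1 / Gamma(1/2)^2 = 1 / pi, so that pi F_D is the integral over (0, 1) of
    1 / sqrt (u (1 - u) (1 - x_1 u) (1 - x_2 u) (1 - x_3 u)). What has to be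
    shown is that, for the three x_j at hand, this integral is C K(k), where C
    is the algebraic prefactor and k the modulus.

    This is an integral on a curve of genus 2, but one with an extra
    involution. If u = (a^2 r^2 - 1) / (a^4 - 1), the six branch points 0, 1,
    oo, 1 / x_j lie at r^2 = a^-2, a^2, oo, 0, b^-2, b^2, and r -> 1 / r
    permutes them. Accordingly the factors pair off into functions of r - 1 / r
    (half_integrand_param). Put r = e^s with - ln a < s < ln a, and
    V(s) = (e^s - e^-s) / (a - 1/a). The differential becomes C times
    e^-s ds / (a - 1/a) over sqrt ((1 - V^2) (1 - k^2 V^2)), and this square
    root is even in s. Adding the values at s and - s turns e^-s into
    e^s + e^-s, that is, into the derivative of V, and the substitution
    x = V(s) on (0, ln a) leaves C K(k) (half_integrand_reduction).

    When all |x_j| < 1, the value of F_D is that of the power series, so the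
    series has to be summed. After u = sin^2 t, Euler's integrand is the
    product of the functions (1 - x_j sin^2 t)^(-1/2). The sum of the series
    over a cube of indices is the integral of the product of the partial sums
    of their binomial series, by Wallis' integrals (lauricella_cube_sum), and
    dominated convergence finishes (lauricella_series_half).

    All these integrands are singular at an end of the interval. The
    substitution rule is therefore proved for nonnegative functions on open
    intervals, as a monotone limit of the rule on compact subintervals. *)

(** * Substitution on open intervals *)

(** Singularities of G and F' at the ends of U are harmless: on each compact
    `[c n, d n] both are continuous, and the two sides pass to the monotone
    limit. The exhaustion is a parameter so that bounded intervals and
    half-lines are covered at once. *)
Lemma ge0_integral_change_of_variables (R : realType) (F F' G : R -> R)
    (c d : nat -> R) (U : set R) :
  open U -> U = \bigcup_n `[c n, d n] ->
  {homo c : n m / (n <= m)%N >-> m <= n} ->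
  {homo d : n m / (n <= m)%N >-> n <= m} ->
  (forall n, c n < d n) ->
  (forall x, U x -> is_derive x (1 : R) F (F' x)) ->
  (forall x, U x -> {for x, continuous F'}) ->
  (forall x, U x -> 0 < F' x) ->
  (forall x, U x -> {for F x, continuous G}) ->
  (forall x, U x -> 0 <= G (F x)) ->
  (\int[@lebesgue_measure R]_(y in F @` U) (G y)%:E =
   \int[@lebesgue_measure R]_(x in U) (G (F x) * F' x)%:E)%E.
Proof.
move=> oU UE cdec dinc cd dF cF' F'0 cG G0.
have sub n : `[c n, d n] `<=` U by rewrite UE => x ?; exists n.
have subo n x : x \in `]c n, d n[%R -> U x.
  by move=> xi; apply: (sub n); exact: (subset_itv_oo_cc xi).
have dFE x : U x -> F^`() x = F' x by move=> /dF H; rewrite derive1E derive_val.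
have cF x : U x -> {for x, continuous F}.
  move=> /dF H; apply/differentiable_continuous/derivable1_diffP.
  exact: ex_derive.
have cdF x : U x -> {for x, continuous F^`()}.
  move=> Ux; rewrite /prop_for /continuous_at (dFE _ Ux).
  apply: cvg_trans (cF' x Ux); apply: near_eq_cvg.
  have := open_nbhs_nbhs (conj oU Ux).
  by apply: filterS => y Uy; rewrite dFE.
have Ucn n : U (c n) by apply: (sub n); rewrite /= in_itv/= lexx ltW.
have Udn n : U (d n) by apply: (sub n); rewrite /= in_itv/= lexx ltW.
have wcF n : {within `[c n, d n], continuous F}.
  by apply: continuous_in_subspaceT => x /[!inE] /sub; exact: cF.
have incF n : {in `[c n, d n]%R &, {homo F : x y / x < y}}.
  apply: gtr0_derive1_lt_cc => //.
  - by move=> x /subo /dF H; exact: ex_derive.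
  - by move=> x /subo Ux; rewrite dFE// F'0.
have incFw n : {in `[c n, d n]%R &, {homo F : x y / x <= y}}.
  move=> x y xi yi; rewrite le_eqVlt => /predU1P[->//|xy].
  by apply/ltW/(incF n).
have im n : F @` `[c n, d n] = `[F (c n), F (d n)].
  have cI : c n \in `[c n, d n]%R by rewrite in_itv/= lexx ltW.
  have dI : d n \in `[c n, d n]%R by rewrite in_itv/= lexx ltW.
  apply/seteqP; split=> [_ [x xcd <-]|y].
    have := xcd; rewrite /= !in_itv/= => /andP[cx xd].
    by rewrite !(incFw n).
  rewrite /= in_itv/= => /andP[Fy yF].
  have FF := incFw n _ _ cI dI (ltW (cd n)).
  have [|x xi xy] := @IVT _ F _ _ y (ltW (cd n)) (wcF n).
    by rewrite min_l// max_r// Fy yF.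
  by exists x.
have imU : F @` U = \bigcup_n `[F (c n), F (d n)].
  rewrite UE image_bigcup; apply: eq_bigcupr => n _; exact: im.
have wcG n : {within `[F (c n), F (d n)], continuous G}.
  apply: continuous_in_subspaceT => y /[!inE].
  by rewrite -im => -[x /sub Ux <-]; exact: cG.
have wcGF n : {within `[c n, d n], continuous (fun x => G (F x) * F' x)}.
  apply: continuous_in_subspaceT => x /[!inE] /sub Ux.
  apply: continuousM; last exact: cF'.
  by apply: continuous_comp; [exact: cF|exact: cG].
have eqn n : (\int[@lebesgue_measure R]_(y in `[F (c n), F (d n)]) (G y)%:E =
   \int[@lebesgue_measure R]_(x in `[c n, d n]) (G (F x) * F' x)%:E)%E.
  rewrite (@integration_by_substitution_increasing _ F G (c n) (d n))//.
  - by apply: eq_integral => x /[!inE] /sub Ux; rewrite !fctE dFE.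
  - exact/ltW.
  - by move=> x /subo; exact: cdF.
  - apply/cvg_ex; exists (F^`() (c n)).
    by apply: cvg_at_right_filter; exact: cdF.
  - apply/cvg_ex; exists (F^`() (d n)).
    by apply: cvg_at_left_filter; exact: cdF.
  - split.
    + by move=> x /subo /dF H; exact: ex_derive.
    + by apply: cvg_at_right_filter; exact: cF.
    + by apply: cvg_at_left_filter; exact: cF.
have sub_cc n m : (n <= m)%N -> `[c n, d n] `<=` `[c m, d m].
  move=> nm x /=; rewrite !in_itv/= => /andP[cx xd].
  by rewrite (le_trans (cdec _ _ nm))//= (le_trans xd)// dinc.
have cvgGF : (\int[@lebesgue_measure R]_(x in `[c n, d n])
      (G (F x) * F' x)%:E)%E @[n --> \oo] -->
    (\int[@lebesgue_measure R]_(x in \bigcup_n `[c n, d n])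
      (G (F x) * F' x)%:E)%E.
  apply: ge0_nondecreasing_set_cvg_integral => //.
  - by move=> n m nm; apply/subsetPset/sub_cc.
  - move=> n; apply/measurable_EFinP.
    by apply: subspace_continuous_measurable_fun => //; exact: wcGF.
  - by move=> n x /sub Ux; rewrite lee_fin mulr_ge0 ?G0// ltW// F'0.
have cvgG : (\int[@lebesgue_measure R]_(y in `[F (c n), F (d n)])
      (G y)%:E)%E @[n --> \oo] -->
    (\int[@lebesgue_measure R]_(y in \bigcup_n `[F (c n), F (d n)])
      (G y)%:E)%E.
  apply: ge0_nondecreasing_set_cvg_integral => //.
  - move=> n m nm; apply/subsetPset; rewrite -!im; apply: image_subset.
    exact: sub_cc.
  - move=> n; apply/measurable_EFinP.
    by apply: subspace_continuous_measurable_fun => //; exact: wcG.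
  - by move=> n y; rewrite -im => -[x /sub Ux <-]; rewrite lee_fin G0.
rewrite imU [in RHS]UE; rewrite (funext eqn) in cvgG.
exact: (cvg_unique _ cvgG cvgGF).
Qed.

Lemma increasing_image_itvoo (R : realType) (F F' : R -> R) (a b : R) : a < b ->
  (forall x, is_derive x (1 : R) F (F' x)) ->
  {in `]a, b[%R, forall x, 0 < F' x} ->
  F @` `]a, b[ = `]F a, F b[.
Proof.
move=> ab dF F'0.
have cF : {within `[a, b], continuous F}.
  apply: continuous_in_subspaceT => x _; have ? := dF x.
  apply/differentiable_continuous/derivable1_diffP; exact: ex_derive.
have incF : {in `[a, b]%R &, {homo F : x y / x < y}}.
  apply: gtr0_derive1_lt_cc => // x xab; have ? := dF x.
  by rewrite derive1E derive_val F'0.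
apply/seteqP; split; first exact: increasing_image_oo.
move=> y; rewrite /= in_itv/= => /andP[ay yb].
have Fab := ltW (lt_trans ay yb).
have [|x xab Fxy] := @IVT R F a b y (ltW ab) cF.
  by rewrite min_l// max_r// !ltW.
exists x => //; move: xab; rewrite /= !in_itv/= !le_eqVlt.
move=> /andP[/predU1P[ax|->] /predU1P[xb|->]]//; exfalso.
- by move: ab; rewrite ax xb ltxx.
- by move: ay; rewrite -Fxy ax ltxx.
- by move: yb; rewrite -Fxy xb ltxx.
Qed.

Lemma ge0_integral_change_of_variables_oo (R : realType) (F F' G : R -> R)
    (a b : R) :
  a < b ->
  (forall x, is_derive x (1 : R) F (F' x)) ->
  continuous F' ->
  {in `]a, b[%R, forall x, 0 < F' x} ->
  {in `]F a, F b[%R, forall y, {for y, continuous G}} ->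
  {in `]F a, F b[%R, forall y, 0 <= G y} ->
  (\int[@lebesgue_measure R]_(y in `]F a, F b[) (G y)%:E =
   \int[@lebesgue_measure R]_(x in `]a, b[) (G (F x) * F' x)%:E)%E.
Proof.
move=> ab dF cF' F'0 cG G0.
have im := increasing_image_itvoo ab dF F'0.
have Fab x : x \in `]a, b[%R -> F x \in `]F a, F b[%R.
  by move=> xab; have : (F @` `]a, b[) (F x) by [exists x]; rewrite im.
rewrite -im.
(* The margins of the exhausting closed intervals; the denominator is at least
   3 so that these intervals are nondegenerate. *)
pose e (n : nat) : R := (b - a) / n.+3%:R.
have ba : 0 < b - a by rewrite subr_gt0.
have edec n m : (n <= m)%N -> e m <= e n.
  by move=> nm; rewrite ler_pM2l// lef_pV2 ?posrE// ler_nat.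
have e0 n : 0 < e n by rewrite divr_gt0.
have eba n : e n * 3 <= b - a.
  by rewrite /e mulrAC ler_pdivrMr// ler_pM2l// ler_nat.
apply: (@ge0_integral_change_of_variables R F F' G
  (fun n => a + e n) (fun n => b - e n)) => //.
- apply/seteqP; split=> [x|x [n _]] /=; rewrite !in_itv/= => /andP[ax xb].
  + have [n na] : exists n, e n < Num.min (x - a) (b - x).
      have m0 : 0 < Num.min (x - a) (b - x) by rewrite lt_min !subr_gt0 ax xb.
      exists (Num.truncn ((b - a) / Num.min (x - a) (b - x))).
      rewrite ltr_pdivrMr// mulrC -ltr_pdivrMr//.
      apply: (lt_le_trans (truncnS_gt _)); rewrite ler_nat.
      by rewrite -[X in (X <= _)%N]addn0 -addn2 leq_add.
    exists n => //; rewrite /= in_itv/=.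
    move: na; rewrite lt_min => /andP[n1 n2].
    by apply/andP; split; lra.
  + have := e0 n; by move=> ?; apply/andP; split; lra.
- by move=> n m /edec; rewrite lerD2l.
- by move=> n m /edec; rewrite lerD2l lerN2.
- by move=> n; have := eba n; have := e0 n; lra.
- by move=> x _; exact: cF'.
- by move=> x /Fab; exact: cG.
- by move=> x /Fab; exact: G0.
Qed.

Lemma ge0_integral_change_of_variables_0y (R : realType) (F F' G : R -> R) :
  {in `]0, +oo[%R, forall x, is_derive x (1 : R) F (F' x)} ->
  {in `]0, +oo[%R, continuous F'} ->
  {in `]0, +oo[%R, forall x, 0 < F' x} ->
  {in `]0, +oo[%R, forall x, {for F x, continuous G}} ->
  {in `]0, +oo[%R, forall x, 0 <= G (F x)} ->
  (\int[@lebesgue_measure R]_(y in F @` `]0%R, +oo[) (G y)%:E =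
   \int[@lebesgue_measure R]_(x in `]0%R, +oo[) (G (F x) * F' x)%:E)%E.
Proof.
move=> dF cF' F'0 cG G0.
apply: (@ge0_integral_change_of_variables R F F' G
  (fun n => n.+2%:R^-1) (fun n => n.+2%:R)) => //.
- apply/seteqP; split=> [x|x [n _]] /=; rewrite !in_itv/= ?andbT.
  + move=> x0.
    exists (maxn (Num.truncn x) (Num.truncn x^-1)) => //.
    rewrite /= in_itv/= -[X in _ <= X]invrK lef_pV2 ?posrE ?invr_gt0//.
    apply/andP; split; rewrite ltW// (lt_le_trans (truncnS_gt _))// ler_nat.
      by rewrite ltnS leqW// leq_maxr.
    by rewrite ltnS leqW// leq_maxl.
  + by move=> /andP[+ _]; apply: lt_le_trans; rewrite invr_gt0.
- by move=> n m nm; rewrite lef_pV2 ?posrE// ler_nat.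
- by move=> n m nm; rewrite ler_nat.
- move=> n; rewrite (@lt_trans _ _ 1)// ?invf_lt1// ?ltr1n//.
Qed.

(** Lebesgue measure is its own image under x -> - x. *)
Lemma ge0_integral_oppr (R : realType) (D : set R) (f : R -> \bar R) :
  measurable D -> measurable_fun D f -> (forall x, D x -> 0 <= f x)%E ->
  (\int[@lebesgue_measure R]_(x in D) f x =
   \int[@lebesgue_measure R]_(x in -%R @^-1` D) f (- x)%R)%E.
Proof.
move=> mD mf f0.
have mN : measurable_fun setT (-%R : measurableTypeR R -> measurableTypeR R).
  exact: oppr_measurable.
transitivity (\int[pushforward (@lebesgue_measure R)
      (-%R : measurableTypeR R -> measurableTypeR R)]_(x in D) f x)%E.
  apply: eq_measure_integral => A mA _; exact/esym/lebesgue_measureN.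
rewrite (@ge0_integral_pushforward _ _ (measurableTypeR R) (measurableTypeR R)
  R _ mN (@lebesgue_measure R) D f mD mf)//.
by move=> x; rewrite inE; exact: f0.
Qed.

Lemma ge0_integral_even_oo (R : realType) (h : R -> R) (a : R) : 0 < a ->
  measurable_fun `]- a, a[ h ->
  (forall x, x \in `]- a, a[%R -> 0 <= h x) ->
  (\int[@lebesgue_measure R]_(x in `](- a)%R, a[) (h x)%:E =
   \int[@lebesgue_measure R]_(x in `]0%R, a[) (h x + h (- x))%:E)%E.
Proof.
move=> a0 mh h0.
have sub0 : `]0, a[ `<=` `]- a, a[.
  by apply: subset_itvr; rewrite bnd_simp oppr_le0 ltW.
have subN : `](- a), 0] `<=` `]- a, a[.
  by apply: subset_itvl; rewrite bnd_simp.
have E : `](- a)%R, a[ = `](- a)%R, 0%R] `|` `]0%R, a[.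
  by rewrite -itv_bndbnd_setU// bnd_simp ?oppr_le0 ?ltW.
have mh' : measurable_fun `]0, a[ (fun x => h (- x)).
  apply: (measurable_comp (F := `]- a, a[)) => //.
  - move=> _ [x + <-]; rewrite /= !in_itv/= => /andP[x0 xa].
    by rewrite ltrN2 xa ltrNl (lt_trans _ x0)// oppr_lt0.
rewrite {1}E ge0_integral_setU//=; last 3 first.
- by rewrite -E; exact/measurable_EFinP.
- by move=> x [/subN|/sub0] xa; rewrite lee_fin h0.
- rewrite disj_set2E; apply/eqP; rewrite -subset0 => x []/=.
  by rewrite !in_itv/= => /andP[_ x0] /andP[+ _]; rewrite ltNge x0.
rewrite ge0_integral_oppr//; last 2 first.
- by apply/measurable_EFinP; exact: measurable_funS mh.
- by move=> x /subN xa; rewrite lee_fin h0.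
have -> : -%R @^-1` `](- a), 0] = `[0, a[ :> set R.
  by apply/seteqP; split=> x; rewrite /= !in_itv/= ltrN2 oppr_le0 andbC.
rewrite -integral_itv_obnd_cbnd; last exact/measurable_EFinP.
rewrite addeC -ge0_integralD//.
- by move=> x /sub0 xa; rewrite lee_fin h0.
- by apply/measurable_EFinP; exact: measurable_funS mh.
- move=> x; rewrite /= in_itv/= => /andP[x0 xa]; rewrite lee_fin h0// in_itv/=.
  by rewrite ltrN2 xa ltrNl (lt_trans _ x0)// oppr_lt0.
- exact/measurable_EFinP.
Qed.

(** * Continuity of square roots and products *)

Lemma is_derive_continuous (R : realType) (f : R -> R) (x df : R) :
  is_derive x (1 : R) f df -> {for x, continuous f}.
Proof.
move=> H; apply/differentiable_continuous/derivable1_diffP; exact: ex_derive.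
Qed.

Lemma continuous_invsqrt (R : realType) (f : R -> R) (x : R) : 0 < f x ->
  {for x, continuous f} -> {for x, continuous (fun y => (Num.sqrt (f y))^-1)}.
Proof.
move=> fx0 cf; apply: continuousV; first by rewrite gt_eqF// sqrtr_gt0.
by apply: continuous_comp => //; exact: sqrt_continuous.
Qed.

Lemma cvg_bigprod (R : realType) (T : Type) (F : set_system T) (FF : Filter F)
    (I : Type) (s : seq I) (f : I -> T -> R) (l : I -> R) :
  (forall i, f i t @[t --> F] --> l i) ->
  \prod_(i <- s) f i t @[t --> F] --> \prod_(i <- s) l i.
Proof.
move=> fl; elim: s => [|i s IH].
  by under eq_fun do rewrite big_nil; rewrite big_nil; exact: cvg_cst.
by under eq_fun do rewrite big_cons; rewrite big_cons; exact: cvgM.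
Qed.

(** * Two values of the Gamma function *)

Lemma powR_Nhalf (R : realType) (t : R) : 0 <= t ->
  t `^ (1 / 2 - 1) = (Num.sqrt t)^-1.
Proof.
move=> t0; rewrite (_ : 1 / 2 - 1 = - 2^-1 :> R); last by lra.
by rewrite powRN powR12_sqrt.
Qed.

Lemma Gamma1 (R : realType) : Gamma (1 : R) = 1.
Proof.
rewrite /Gamma /Rintegral.
rewrite integral_itv_obnd_cbnd; last first.
  apply/measurable_EFinP; apply: measurable_funM.
    rewrite (_ : (fun t : R => _) = cst 1); first exact: measurable_cst.
    by apply/funext => t; rewrite subrr powRr0.
  apply: measurable_funTS; apply: continuous_measurable_fun => x.
  by apply: continuous_comp; [exact: opp_continuous|exact: continuous_expR].
rewrite -[RHS]/(fine 1%E) -(@integral_exponential_pdf R 1 ltr01); congr fine.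
rewrite integral_mkcond; apply: eq_integral => x _.
rewrite /exponential_pdf !patchE; case: ifP => // _.
by rewrite subrr powRr0 mulN1r.
Qed.

(** The substitution t = x ^ 2 yields twice the half-line Gaussian integral. *)
Lemma Gamma_half (R : realType) : Gamma (1 / 2 : R) = Num.sqrt pi.
Proof.
rewrite /Gamma /Rintegral.
pose G (t : R) := (Num.sqrt t)^-1 * expR (- t).
have im : (fun x : R => x ^+ 2) @` `]0, +oo[ = `]0, +oo[.
  apply/seteqP; split=> [_ [x xI <-]|y yI].
    by move: xI; rewrite /= !in_itv/= !andbT => x0; rewrite exprn_gt0.
  move: yI; rewrite /= in_itv/= andbT => y0; exists (Num.sqrt y).
    by rewrite /= in_itv/= andbT sqrtr_gt0.
  by rewrite sqr_sqrtr// ltW.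
transitivity (fine (\int[@lebesgue_measure R]_(t in `]0%R, +oo[) (G t)%:E)).
  congr fine; apply: eq_integral => t; rewrite inE/= in_itv/= andbT => t0.
  by rewrite powR_Nhalf// ltW.
rewrite -im (@ge0_integral_change_of_variables_0y _ _ (fun x => 2 * x)).
- transitivity (fine (2%:E * \int[@lebesgue_measure R]_(x in `]0%R, +oo[)
    (gauss_fun x)%:E)); last first.
    rewrite integral_itv_obnd_cbnd; last first.
      apply/measurable_EFinP; apply: measurable_funTS.
      exact: measurable_gauss_fun.
    by rewrite integral0y_gauss/= mulrCA divff// mulr1.
  rewrite -ge0_integralZl//; last 2 first.
  + apply/measurable_EFinP; apply: measurable_funTS.
    exact: measurable_gauss_fun.
  + by move=> x _; rewrite lee_fin gauss_fun_ge0.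
  congr fine; apply: eq_integral => x; rewrite inE/= in_itv/= andbT => x0.
  rewrite -EFinM; congr EFin; rewrite /G sqrtr_sqr gtr0_norm// /gauss_fun.
  by field; exact: lt0r_neq0.
- by move=> x _; apply: is_derive_eq; rewrite /GRing.scale/=; ring.
- by move=> x _; exact: mulrl_continuous.
- by move=> x; rewrite in_itv/= andbT => x0; rewrite mulr_gt0.
- move=> x; rewrite in_itv/= andbT => x0; apply: continuousM.
  + apply: continuousV; last exact: sqrt_continuous.
    by rewrite gt_eqF// sqrtr_gt0 exprn_gt0.
  + by apply: continuous_comp; [exact: opp_continuous|exact: continuous_expR].
- by move=> x _; rewrite /G mulr_ge0 ?invr_ge0 ?sqrtr_ge0 ?expR_ge0.
Qed.

(** * The complete elliptic integral *)

Lemma cos_gt0_0pihalf (R : realType) (t : R) :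
  t \in `]0, pi / 2[%R -> 0 < cos t.
Proof.
rewrite in_itv/= => /andP[t0 t1]; apply: cos_gt0_pihalf.
by rewrite t1 andbT (lt_trans _ t0)// oppr_lt0 divr_gt0// pi_gt0.
Qed.

Lemma sqr_sin_le1 (R : realType) (t : R) : sin t ^+ 2 <= 1.
Proof. by rewrite sin2cos2 gerBl sqr_ge0. Qed.

Lemma lebesgue_measure_0pihalf (R : realType) :
  (@lebesgue_measure R `]0%R, (pi / 2)%R[ = (pi / 2)%:E)%E.
Proof.
by rewrite lebesgue_measure_itv/= lte_fin divr_gt0 ?pi_gt0// oppr0 adde0.
Qed.

(** The substitution x = sin t removes the singularity at x = 1. *)
Lemma ellipticK_trig (R : realType) (k : R) : k ^+ 2 < 1 ->
  (\int[@lebesgue_measure R]_(x in `]0%R, 1%R[)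
    (Num.sqrt ((1 - x ^+ 2) * (1 - k ^+ 2 * x ^+ 2)))^-1%:E =
   \int[@lebesgue_measure R]_(t in `]0%R, (pi / 2)%R[)
    (Num.sqrt (1 - k ^+ 2 * sin t ^+ 2))^-1%:E)%E.
Proof.
move=> k1.
pose G (x : R) := (Num.sqrt ((1 - x ^+ 2) * (1 - k ^+ 2 * x ^+ 2)))^-1.
have := @ge0_integral_change_of_variables_oo _ sin cos G 0 (pi / 2).
rewrite sin0 sin_pihalf => ->//.
- apply: eq_integral => t /[!inE] ti; congr EFin; rewrite /G.
  have c0 := cos_gt0_0pihalf ti.
  rewrite -cos2sin2 sqrtrM ?sqr_ge0// sqrtr_sqr gtr0_norm// invfM mulrAC.
  by rewrite mulVf ?gt_eqF// mul1r.
- by rewrite divr_gt0// pi_gt0.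
- exact: continuous_cos.
- by move=> x; exact: cos_gt0_0pihalf.
- move=> x; rewrite in_itv/= => /andP[x0 x1].
  apply: continuous_invsqrt; last exact: is_derive_continuous.
  have x2 : x ^+ 2 < 1 by rewrite expr_lt1// ltW.
  rewrite mulr_gt0 ?subr_gt0// (le_lt_trans _ k1)//.
  by rewrite ler_piMr ?sqr_ge0// ltW.
- by move=> x _; rewrite invr_ge0 sqrtr_ge0.
Qed.

(** Both claims come from comparing the trigonometric integrand with the
    constants 1 and 1 / sqrt (1 - k ^ 2) on an interval of finite length. *)
Lemma ellipticK_gt0_fin (R : realType) (k : R) : k ^+ 2 < 1 ->
  0 < ellipticK k /\
  (\int[@lebesgue_measure R]_(x in `]0%R, 1%R[)
    (Num.sqrt ((1 - x ^+ 2) * (1 - k ^+ 2 * x ^+ 2)))^-1%:E =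
  (ellipticK k)%:E)%E.
Proof.
move=> k1; rewrite /ellipticK /Rintegral (ellipticK_trig k1).
set I := (X in (X = _)%E).
have len : (@lebesgue_measure R `]0%R, (pi / 2)%R[ = (pi / 2)%:E)%E.
  exact: lebesgue_measure_0pihalf.
have ksin t : 0 < 1 - k ^+ 2 * sin t ^+ 2.
  by rewrite subr_gt0 (le_lt_trans _ k1)// ler_piMr ?sqr_ge0 ?sqr_sin_le1.
have mf : measurable_fun `]0%R, (pi / 2)%R[
    (fun t : R => (Num.sqrt (1 - k ^+ 2 * sin t ^+ 2))^-1).
  apply: measurable_funTS; apply: continuous_measurable_fun => t.
  apply: (@continuous_invsqrt _ (fun t => 1 - k ^+ 2 * sin t ^+ 2)) => //.
  exact: is_derive_continuous.
have Ige : ((pi / 2)%:E <= I)%E.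
  rewrite -len -[leLHS]mul1e -integral_cst//; apply: ge0_le_integral => //.
  - exact/measurable_EFinP.
  - move=> t _; rewrite lee_fin invf_ge1 ?sqrtr_gt0//.
    by rewrite -[leRHS]sqrtr1 ler_sqrt// gerBl mulr_ge0 ?sqr_ge0.
have Ile : (I <= ((Num.sqrt (1 - k ^+ 2))^-1 * (pi / 2))%:E)%E.
  rewrite EFinM -len -integral_cst//; apply: ge0_le_integral => //.
  - exact/measurable_EFinP.
  - move=> t _; rewrite lee_fin lef_pV2 ?posrE ?sqrtr_gt0 ?ksin
      ?[0 < _ - _]subr_gt0//.
    rewrite ler_sqrt ?(ltW (ksin _))// lerD2l lerN2.
    by rewrite ler_piMr ?sqr_ge0 ?sqr_sin_le1.
have Ifin : I \is a fin_num.
  rewrite ge0_fin_numE; first by rewrite (le_lt_trans Ile) ?ltry.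
  by apply: le_trans Ige; rewrite lee_fin divr_ge0// pi_ge0.
split; last by rewrite fineK.
by rewrite -lte_fin fineK// (lt_le_trans _ Ige)// lte_fin divr_gt0// pi_gt0.
Qed.

(** * Euler's integral for the parameters 1/2, 1/2, 1 *)

(** Euler's integrand for alpha = beta_j = 1/2 and gamma = 1, with square roots
    in place of the real powers. *)
Definition half_integrand (R : realType) (n : nat) (x : n.-tuple R) (u : R)
    : R :=
  (Num.sqrt (u * (1 - u)))^-1 * \prod_(j < n) (Num.sqrt (1 - tnth x j * u))^-1.

Lemma lauricella_integral_half (R : realType) (n : nat) (beta x : n.-tuple R) :
  (forall j, tnth beta j = 1 / 2) -> (forall j, tnth x j < 1) ->
  lauricella_integral (1 / 2) beta 1 x =
  pi^-1 * \int[@lebesgue_measure R]_(u in `]0, 1[) half_integrand x u.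
Proof.
move=> hbeta x1; rewrite /lauricella_integral Gamma1.
rewrite (_ : 1 - 1 / 2 = 1 / 2 :> R); last by lra.
rewrite Gamma_half -expr2 sqr_sqrtr ?pi_ge0// mul1r; congr (_ * _).
apply: eq_Rintegral => u; rewrite inE/= in_itv/= => /andP[u0 u1].
rewrite !powR_Nhalf ?subr_ge0 ?ltW// /half_integrand sqrtrM ?ltW// invfM.
congr (_ * _); rewrite prodfV; congr (_^-1); apply: eq_bigr => j _.
rewrite hbeta div1r powR12_sqrt// subr_ge0.
have [xj0|/ltW xj0] := leP 0 (tnth x j); last first.
  by rewrite (le_trans _ ler01)// mulr_le0_ge0// ltW.
by rewrite mulr_ile1// ltW.
Qed.

Lemma half_integrand_ge0 (R : realType) (n : nat) (x : n.-tuple R) (u : R) :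
  0 <= half_integrand x u.
Proof.
rewrite mulr_ge0 ?invr_ge0 ?sqrtr_ge0//.
by apply: prodr_ge0 => j _; rewrite invr_ge0 sqrtr_ge0.
Qed.

Lemma continuous_half_integrand (R : realType) (n : nat) (x : n.-tuple R)
    (u : R) :
  0 < u < 1 -> (forall j, tnth x j < 1) ->
  {for u, continuous (half_integrand x)}.
Proof.
move=> /andP[u0 u1] x1; apply: continuousM.
  apply: (@continuous_invsqrt _ (fun u => u * (1 - u))).
    by rewrite mulr_gt0// subr_gt0.
  exact: is_derive_continuous.
have cj j : {for u, continuous (fun u => (Num.sqrt (1 - tnth x j * u))^-1)}.
  apply: (@continuous_invsqrt _ (fun u => 1 - tnth x j * u)).
    have := x1 j; nra.
  exact: is_derive_continuous.
exact: (@cvg_bigprod _ _ (nbhs u) _ _ _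
  (fun j u => (Num.sqrt (1 - tnth x j * u))^-1)).
Qed.

(** The substitution u = sin^2 t; the weight 1 / sqrt (u (1 - u)) is the
    arcsine one: it cancels against du = 2 sin t cos t dt up to the factor 2. *)
Lemma half_integrand_trig (R : realType) (n : nat) (x : n.-tuple R) :
  (forall j, tnth x j < 1) ->
  (\int[@lebesgue_measure R]_(u in `]0%R, 1%R[) (half_integrand x u)%:E =
   \int[@lebesgue_measure R]_(t in `]0%R, (pi / 2)%R[)
     (2 * \prod_(j < n) (Num.sqrt (1 - tnth x j * sin t ^+ 2))^-1)%:E)%E.
Proof.
move=> x1.
have sin_gt0 (t : R) : t \in `]0, pi / 2[%R -> 0 < sin t.
  by rewrite in_itv/=; exact: sin_gt0_pihalf.
have dS (t : R) : is_derive t 1 (fun t => sin t ^+ 2) (2 * sin t * cos t).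
  by apply: is_derive_eq; rewrite /GRing.scale/=; ring.
have := @ge0_integral_change_of_variables_oo _ (fun t => sin t ^+ 2)
  (fun t => 2 * sin t * cos t) (half_integrand x) 0 (pi / 2).
rewrite sin0 sin_pihalf expr0n expr1n/= => ->.
- apply: eq_integral => t /[!inE] ti; congr EFin; rewrite /half_integrand.
  have c0 := cos_gt0_0pihalf ti; have s0 := sin_gt0 _ ti.
  rewrite -cos2sin2 -exprMn sqrtr_sqr gtr0_norm ?mulr_gt0//.
  by field; rewrite !gt_eqF.
- by rewrite divr_gt0// pi_gt0.
- by move=> t; exact: is_derive_continuous.
- by move=> t ti; rewrite !mulr_gt0 ?sin_gt0 ?cos_gt0_0pihalf.
- move=> u; rewrite in_itv/= => u01.
  exact: continuous_half_integrand.
- by move=> u _; exact: half_integrand_ge0.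
Qed.

(** * Pochhammer symbols and Wallis' integrals *)

Lemma pochhammerS (R : realType) (x : R) (k : nat) :
  pochhammer x k.+1 = pochhammer x k * (x + k%:R).
Proof. by rewrite /pochhammer big_ord_recr. Qed.

Lemma pochhammer1 (R : realType) (k : nat) : pochhammer (1 : R) k = k`!%:R.
Proof.
elim: k => [|k IH]; first by rewrite /pochhammer big_ord0.
by rewrite pochhammerS IH factS natrM mulrC nat1r.
Qed.

Lemma is_derive_funX (R : realType) (f : R -> R) (m : nat) (t df : R) :
  is_derive t 1 f df ->
  is_derive t 1 (fun x => f x ^+ m) (m%:R * f t ^+ m.-1 * df).
Proof.
move=> H; have -> : (fun x => f x ^+ m) = f ^+ m.
  by apply/funext => x; rewrite fctE.
exact: is_deriveX.
Qed.

Lemma continuous_integrable_oo (R : realType) (f : R -> R) (a b : R) :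
  continuous f -> (@lebesgue_measure R).-integrable `]a, b[ (EFin \o f).
Proof.
move=> cf.
apply: (@integrableS _ _ R (@lebesgue_measure R) `[a, b]%classic) => //.
  exact: subset_itv_oo_cc.
apply: continuous_compact_integrable; first exact: segment_compact.
exact: continuous_subspaceT.
Qed.

(** The derivative of sin^(m+1) cos is (m+1) sin^m - (m+2) sin^(m+2), and this
    primitive vanishes at 0 and at pi / 2. *)
Lemma Wallis_rec (R : realType) (m : nat) :
  (m.+2)%:R * \int[@lebesgue_measure R]_(t in `]0, pi / 2[) (sin t ^+ m.+2) =
  (m.+1)%:R * \int[@lebesgue_measure R]_(t in `]0, pi / 2[) (sin t ^+ m).
Proof.
pose f (t : R) := m.+1%:R * sin t ^+ m - m.+2%:R * sin t ^+ m.+2.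
have cs k : continuous (fun t : R => sin t ^+ k).
  by move=> t; apply: is_derive_continuous; exact: is_derive_funX.
have cZ r k : continuous (fun t : R => r * sin t ^+ k).
  by move=> t; apply: cvgM; [exact: cvg_cst|exact: cs].
have cf : continuous f by move=> t; apply: cvgB; exact: cZ.
have dF (t : R) : is_derive t 1 (fun t => sin t ^+ m.+1 * cos t) (f t).
  have ? := @is_derive_funX R _ m.+1 _ _ (is_derive_sin t).
  apply: is_derive_eq; rewrite /f /GRing.scale/=.
  rewrite !exprS; have := sin2cos2 t; rewrite expr2 => sc.
  transitivity (sin t ^+ m * (m.+1%:R * (cos t ^+ 2) - sin t * sin t)).
    by rewrite expr2; ring.
  rewrite cos2sin2 expr2 -[in RHS]nat1r; ring.
have FTC : \int[@lebesgue_measure R]_(t in `]0, pi / 2[) f t = 0.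
  rewrite /Rintegral -(@integral_itv_bndoo _ _ _ _ true false); last first.
    apply/measurable_EFinP; apply: measurable_funTS.
    exact: continuous_measurable_fun.
  rewrite (@continuous_FTC2 _ _ (fun t => sin t ^+ m.+1 * cos t)).
  - by rewrite cos_pihalf sin0 mulr0 exprS !mul0r -EFinB subrr.
  - by rewrite divr_gt0// pi_gt0.
  - exact: continuous_subspaceT.
  - have cF (t : R) := is_derive_continuous (dF t).
    split; first by move=> t _; have := dF t => ?; exact: ex_derive.
      by apply: cvg_at_right_filter; exact: cF.
    by apply: cvg_at_left_filter; exact: cF.
  - move=> t _; have ? := dF t; rewrite derive1E; exact: derive_val.
have := FTC; rewrite RintegralB//; last 2 first.
- exact: continuous_integrable_oo.
- exact: continuous_integrable_oo.
rewrite !RintegralZl//; try exact: continuous_integrable_oo.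
by move=> /eqP; rewrite subr_eq0 => /eqP ->.
Qed.

(** Up to the factor pi / 2 this is B(k + 1/2, 1/2) / B(1/2, 1/2), the source of
    the factor (alpha)_M / (gamma)_M of the Lauricella series. *)
Lemma Wallis_even (R : realType) (k : nat) :
  \int[@lebesgue_measure R]_(t in `]0, pi / 2[) ((sin t ^+ 2) ^+ k) =
  pi / 2 * (pochhammer (1 / 2) k / pochhammer 1 k).
Proof.
elim: k => [|k IH].
  rewrite /pochhammer !big_ord0 divr1 mulr1.
  rewrite (_ : (fun t => _) = cst 1)//.
  by rewrite Rintegral_cst// mul1r /= lebesgue_measure_0pihalf.
have := Wallis_rec R k.*2; rewrite -doubleS.
have E j : (fun t : R => (sin t ^+ 2) ^+ j) = (fun t => sin t ^+ j.*2).
  by apply/funext => t; rewrite -exprM mul2n.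
rewrite E in IH; rewrite E IH => h.
rewrite !pochhammerS !pochhammer1.
have k2 : k.+1.*2%:R = 2 * (1 + k%:R) :> R by rewrite -mul2n natrM nat1r.
have k1 : k.*2.+1%:R = 2 * (1 / 2 + k%:R) :> R.
  by rewrite -addn1 natrD -mul2n natrM; field.
have k0 : 1 + k%:R != 0 :> R by rewrite nat1r pnatr_eq0.
have f0 : k`!%:R != 0 :> R by rewrite pnatr_eq0 -lt0n fact_gt0.
move: h; rewrite k2 k1 pochhammer1 => h.
apply: (mulfI (_ : 2 * (1 + k%:R) != 0)); first by rewrite mulf_neq0.
by rewrite h; field; rewrite k0 f0.
Qed.

(** * The binomial series of the inverse square root *)

(** The Taylor coefficients of (1 - y)^(-1/2). *)
Definition invsqrt_coef (R : realType) (k : nat) : R :=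
  pochhammer (1 / 2) k / k`!%:R.

Lemma invsqrt_coefS (R : realType) (k : nat) :
  k.+1%:R * invsqrt_coef R k.+1 = (k%:R + 1 / 2) * invsqrt_coef R k.
Proof.
rewrite /invsqrt_coef pochhammerS factS natrM -nat1r.
have k0 : 1 + k%:R != 0 :> R by rewrite nat1r pnatr_eq0.
have f0 : k`!%:R != 0 :> R by rewrite pnatr_eq0 -lt0n fact_gt0.
by field; rewrite k0 f0.
Qed.

Lemma invsqrt_coef_ge0 (R : realType) (k : nat) : 0 <= invsqrt_coef R k.
Proof.
by rewrite divr_ge0//; apply: prodr_ge0 => i _; rewrite addr_ge0// ltW.
Qed.

Lemma invsqrt_coef_le1 (R : realType) (k : nat) : invsqrt_coef R k <= 1.
Proof.
elim: k => [|k IH]; first by rewrite /invsqrt_coef /pochhammer big_ord0 divr1.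
rewrite -(@ler_pM2l _ k.+1%:R)// mulr1 invsqrt_coefS.
apply: (@le_trans _ _ (k%:R + 1 / 2)).
  by rewrite ler_piMr// addr_ge0//; lra.
by rewrite -[leRHS]natr1 lerD2l; lra.
Qed.

Definition invsqrt_sum (R : realType) (N : nat) (y : R) : R :=
  \sum_(k < N) invsqrt_coef R k * y ^+ k.

(** Comparison with the geometric series; the bound does not depend on N, as
    dominated convergence requires. *)
Lemma invsqrt_sum_bound (R : realType) (N : nat) (y : R) : `|y| < 1 ->
  `|invsqrt_sum N y| <= (1 - `|y|)^-1.
Proof.
move=> y1; apply: (@le_trans _ _ (\sum_(k < N) `|y| ^+ k)).
  apply: (le_trans (ler_norm_sum _ _ _)); apply: ler_sum => k _.
  rewrite normrM normrX ger0_norm ?invsqrt_coef_ge0//.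
  by rewrite ler_piMl ?exprn_ge0// invsqrt_coef_le1.
have y1' : 0 < 1 - `|y| by rewrite subr_gt0.
rewrite -[leRHS]mul1r ler_pdivlMr// mulrC.
have -> : (1 - `|y|) * \sum_(k < N) `|y| ^+ k = 1 - `|y| ^+ N.
  by rewrite -opprB mulNr -subrX1 opprB.
by rewrite gerBl exprn_ge0.
Qed.

Lemma is_derive_invsqrt_sum (R : realType) (N : nat) (y : R) :
  is_derive y 1 (invsqrt_sum N)
    (\sum_(k < N) invsqrt_coef R k * (k%:R * y ^+ k.-1)).
Proof.
have -> : invsqrt_sum N = \sum_(k < N) (fun y : R => invsqrt_coef R k * y ^+ k).
  by apply/funext => z; rewrite fct_sumE.
apply: is_derive_sum => k.
have ? := @is_derive_funX R _ k _ _ (is_derive_id y (1 : R)).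
by apply: is_derive_eq; rewrite /GRing.scale/= mulr1.
Qed.

(** (1 - y)^(-1/2) solves (1 - y) f' = f / 2; the partial sum solves it up to
    one monomial, because all other terms telescope. *)
Lemma invsqrt_sum_ode (R : realType) (N : nat) (y : R) :
  (1 - y) * (\sum_(k < N.+1) invsqrt_coef R k * (k%:R * y ^+ k.-1))
  - 1 / 2 * invsqrt_sum N.+1 y = - (N.+1%:R * invsqrt_coef R N.+1 * y ^+ N).
Proof.
elim: N => [|N IH].
  rewrite /invsqrt_sum !big_ord_recr !big_ord0/= invsqrt_coefS.
  by rewrite !mul0r !mulr0 !add0r expr0; ring.
rewrite /invsqrt_sum big_ord_recr [in X in _ - X]big_ord_recr/=.
rewrite -/(invsqrt_sum N.+1 y).
rewrite !mulrDr opprD addrACA IH [in RHS]invsqrt_coefS.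
by rewrite [y ^+ N.+1]exprS; ring.
Qed.

Lemma is_derive_invsqrt_sum_sqrt (R : realType) (N : nat) (y : R) : y < 1 ->
  is_derive y 1 (fun y => invsqrt_sum N.+1 y * Num.sqrt (1 - y))
    (- (N.+1%:R * invsqrt_coef R N.+1 * y ^+ N) / Num.sqrt (1 - y)).
Proof.
move=> y1.
have y1' : 0 < 1 - y by rewrite subr_gt0.
have ? := is_derive_invsqrt_sum N.+1 y.
have ? : is_derive y 1 (fun y => Num.sqrt (1 - y))
    (- (2 * Num.sqrt (1 - y))^-1).
  apply: is_derive_eq.
    apply: (@is_derive1_comp _ _ (fun y => 1 - y)); exact: is_derive1_sqrt.
  by rewrite add0r mul1r mulrN1.
apply: is_derive_eq; rewrite -invsqrt_sum_ode /GRing.scale/=.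
have s0 : Num.sqrt (1 - y) != 0 by rewrite gt_eqF// sqrtr_gt0.
have sq : Num.sqrt (1 - y) ^+ 2 = 1 - y by rewrite sqr_sqrtr ?ltW.
set D := \sum_(k < _) _; have -> : (1 - y) * D = Num.sqrt (1 - y) ^+ 2 * D.
  by rewrite sq.
by field.
Qed.

(** With r = s ^ 2, one of the two factors s ^ n absorbs n + 1, because
    (n + 1) s ^ n is at most the geometric sum 1 + s + ... + s ^ n, and the other
    one tends to 0. *)
Lemma cvg_natr_geometric (R : realType) (r : R) : 0 <= r < 1 ->
  (n.+1%:R * r ^+ n) @[n --> \oo] --> 0.
Proof.
move=> /andP[r0 r1]; pose s := Num.sqrt r.
have s0 : 0 <= s by exact: sqrtr_ge0.
have s1 : s < 1 by rewrite -[ltRHS]sqrtr1 ltr_sqrt.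
have s1' : 0 < 1 - s by rewrite subr_gt0.
have bnd n : n.+1%:R * s ^+ n <= (1 - s)^-1.
  rewrite -[leRHS]mul1r ler_pdivlMr// mulrC.
  apply: (@le_trans _ _ ((1 - s) * \sum_(k < n.+1) s ^+ k)).
    rewrite ler_pM2l// mulr_natl -[X in _ *+ X](card_ord n.+1) -sumr_const.
    apply: ler_sum => k _.
    by apply: ler_wiXn2l; rewrite ?s0 ?(ltW s1)// -ltnS.
  rewrite -[1 - s]opprB mulNr -subrX1 opprB.
  by rewrite gerBl exprn_ge0.
apply: (squeeze_cvgr (f := fun=> 0) (h := fun n => (1 - s)^-1 * s ^+ n)).
- apply: nearW => n; rewrite mulr_ge0 ?exprn_ge0//=.
  by rewrite -{1}(sqr_sqrtr r0) -/s exprAC expr2 mulrA ler_wpM2r ?exprn_ge0.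
- exact: cvg_cst.
- by apply: (@cvg_geometric _ (1 - s)^-1); rewrite ger0_norm.
Qed.

(** By invsqrt_sum_ode, the partial sum times sqrt (1 - y) has as derivative a
    monomial of high degree over sqrt (1 - y), so the mean value theorem between
    0 and y keeps this product within O(N |y|^N) of its value 1 at 0. *)
Lemma invsqrt_sum_cvg (R : realType) (y : R) : `|y| < 1 ->
  invsqrt_sum N y @[N --> \oo] --> (Num.sqrt (1 - y))^-1.
Proof.
move=> y1; have y1' : y < 1 by exact: le_lt_trans (ler_norm y) y1.
have s0 : 0 < Num.sqrt (1 - y) by rewrite sqrtr_gt0 subr_gt0.
have t0 : 0 < Num.sqrt (1 - `|y|) by rewrite sqrtr_gt0 subr_gt0.
rewrite -(cvg_shiftS (fun N => invsqrt_sum N y)).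
suff : invsqrt_sum N.+1 y * Num.sqrt (1 - y) @[N --> \oo] --> (1 : R).
  move=> h; rewrite -[(Num.sqrt (1 - y))^-1]mul1r.
  rewrite (_ : (fun n => _) = fun N =>
      invsqrt_sum N.+1 y * Num.sqrt (1 - y) / Num.sqrt (1 - y)).
    by apply: cvgM => //; exact: cvg_cst.
  by apply/funext => N; rewrite mulfK// gt_eqF.
pose e (N : nat) : R := (Num.sqrt (1 - `|y|))^-1 * (N.+1%:R * `|y| ^+ N).
have ecvg : e N @[N --> \oo] --> 0.
  rewrite -(mulr0 (Num.sqrt (1 - `|y|))^-1).
  by apply: cvgM; [exact: cvg_cst|apply: cvg_natr_geometric; rewrite normr_ge0].
have bnd N : `|1 - invsqrt_sum N.+1 y * Num.sqrt (1 - y)| <= e N.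
  pose h (z : R) := invsqrt_sum N.+1 z * Num.sqrt (1 - z).
  have h0 : h 0 = 1.
    rewrite /h subr0 sqrtr1 mulr1 /invsqrt_sum big_ord_recl big1 => [|k _].
      by rewrite /invsqrt_coef /pochhammer big_ord0 divr1 mulr1 addr0.
    by rewrite /= expr0n mulr0.
  have dh (z : R) : z < 1 -> is_derive z 1 h
    (- (N.+1%:R * invsqrt_coef R N.+1 * z ^+ N) / Num.sqrt (1 - z)).
    exact: is_derive_invsqrt_sum_sqrt.
  have dbnd (z : R) : `|z| <= `|y| ->
      `|- (N.+1%:R * invsqrt_coef R N.+1 * z ^+ N) / Num.sqrt (1 - z)| <= e N.
    move=> zy; have z1 : z < 1.
      exact: le_lt_trans (ler_norm z) (le_lt_trans zy y1).
    rewrite normrM normrN normrM (normrM N.+1%:R) normrX normr_nat.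
    rewrite (ger0_norm (invsqrt_coef_ge0 _ _)) normfV (ger0_norm (sqrtr_ge0 _)).
    rewrite mulrC /e ler_pM ?invr_ge0 ?sqrtr_ge0//.
    - by rewrite mulr_ge0 ?exprn_ge0// mulr_ge0// invsqrt_coef_ge0.
    - rewrite lef_pV2 ?posrE ?sqrtr_gt0 ?subr_gt0//.
      rewrite ler_sqrt ?subr_ge0 ?(ltW z1)// lerD2l lerN2.
      exact: le_trans (ler_norm z) zy.
    - rewrite -mulrA ler_wpM2l// -[leRHS]mul1r.
      by rewrite ler_pM ?exprn_ge0 ?invsqrt_coef_ge0 ?invsqrt_coef_le1 ?lerXn2r
        ?nnegrE.
  have MV (a b : R) : a <= b ->
      (forall z : R, z \in `[a, b]%R -> `|z| <= `|y|) ->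
      `|h b - h a| <= e N * (b - a).
    move=> ab abz.
    have ab1 (z : R) : z \in `[a, b]%R -> z < 1.
      by move=> /abz zy; exact: le_lt_trans (ler_norm z) (le_lt_trans zy y1).
    have [z|/=|c cab ->] := @MVT_segment R h (fun z =>
      - (N.+1%:R * invsqrt_coef R N.+1 * z ^+ N) / Num.sqrt (1 - z)) a b ab.
    - by move=> zab; apply: dh; apply: ab1; exact: subset_itv_oo_cc zab.
    - apply: continuous_in_subspaceT => z /[!inE] /ab1 /dh.
      exact: is_derive_continuous.
    - rewrite normrM (ger0_norm (_ : 0 <= b - a)) ?subr_ge0//.
      by rewrite ler_wpM2r ?subr_ge0// dbnd// abz.
  have e0 : 0 <= e N by rewrite !mulr_ge0 ?invr_ge0 ?sqrtr_ge0 ?exprn_ge0.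
  (* MV needs its endpoints in order, hence the two signs of y. *)
  rewrite -/(h y) -h0; have [y0|y0] := leP 0 y.
    rewrite distrC; apply: (le_trans (MV 0 y y0 _)).
      move=> z; rewrite in_itv/= => /andP[z0 zy]; by rewrite !ger0_norm.
    by rewrite subr0 ler_piMr// ltW.
  apply: (le_trans (MV y 0 (ltW y0) _)).
    move=> z; rewrite in_itv/= => /andP[z0 zy].
    by rewrite !ler0_norm// ?lerN2// ltW.
  by rewrite sub0r ler_piMr// -ler0_norm ?ltW.
apply/cvgrPdist_le => eps eps0.
move/cvgrPdist_le : ecvg => /(_ eps eps0); apply: filterS => N.
rewrite sub0r normrN => eN; apply: (le_trans (bnd N)).
exact: le_trans (ler_norm _) eN.
Qed.

(** * The series inside the polydisc *)

Lemma continuous_bigsum (R : realType) (I : Type) (s : seq I)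
    (f : I -> R -> R) :
  (forall i, continuous (f i)) -> continuous (fun t => \sum_(i <- s) f i t).
Proof.
move=> cf t.
change (\sum_(i <- s) f i u @[u --> t] --> \sum_(i <- s) f i t).
elim: s => [|i s IH].
  by under eq_fun do rewrite big_nil; rewrite big_nil; exact: cvg_cst.
under eq_fun do rewrite big_cons; rewrite big_cons; apply: cvgD => //.
exact: cf.
Qed.

Lemma Rintegral_sum_oo (R : realType) (I : Type) (s : seq I) (f : I -> R -> R)
    (a b : R) : (forall i, continuous (f i)) ->
  \int[@lebesgue_measure R]_(t in `]a, b[) (\sum_(i <- s) f i t) =
  \sum_(i <- s) \int[@lebesgue_measure R]_(t in `]a, b[) f i t.
Proof.
move=> cf; elim: s => [|i s IH].
  rewrite big_nil -[RHS](mul0r (fine (@lebesgue_measure R `]a, b[))).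
  by rewrite -Rintegral_cst//; apply: eq_Rintegral => t _; rewrite /= big_nil.
rewrite big_cons -IH -RintegralD//; last 2 first.
- exact: continuous_integrable_oo.
- by apply: continuous_integrable_oo; exact: continuous_bigsum.
by apply: eq_Rintegral => t _; rewrite /= big_cons.
Qed.

(** Expanding the product of partial sums gives one term for each index vector
    m in the cube; its power of sin t has exponent twice the sum of the m_j, and
    Wallis' integral turns it into the factor shared by the m with that sum. *)
Lemma lauricella_cube_sum (R : realType) (n N : nat) (beta x : n.-tuple R) :
  (forall j, tnth beta j = 1 / 2) ->
  \sum_(m : {ffun 'I_n -> 'I_N})
    lauricella_term (1 / 2) beta 1 x (fun j => m j : nat) =
  2 / pi * \int[@lebesgue_measure R]_(t in `]0, pi / 2[)
    \prod_(j < n) invsqrt_sum N (tnth x j * sin t ^+ 2).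
Proof.
move=> hbeta.
pose C (m : {ffun 'I_n -> 'I_N}) : R :=
  \prod_(j < n) (invsqrt_coef R (m j) * tnth x j ^+ m j).
pose M (m : {ffun 'I_n -> 'I_N}) : nat := (\sum_(j < n) m j)%N.
have expand t : \prod_(j < n) invsqrt_sum N (tnth x j * sin t ^+ 2) =
    \sum_(m : {ffun 'I_n -> 'I_N}) C m * (sin t ^+ 2) ^+ M m.
  rewrite bigA_distr_bigA; apply: eq_bigr => m _.
  rewrite /C /M -prodrXr -big_split/=; apply: eq_bigr => j _.
  by rewrite exprMn mulrA.
have cs k : continuous (fun t : R => (sin t ^+ 2) ^+ k).
  move=> t; apply: is_derive_continuous; exact: is_derive_funX.
rewrite (_ : (fun t => _) = fun t : R =>
    \sum_(m : {ffun 'I_n -> 'I_N}) C m * (sin t ^+ 2) ^+ M m); last first.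
  by apply/funext.
rewrite Rintegral_sum_oo; last first.
  by move=> m t; apply: cvgM; [exact: cvg_cst|exact: cs].
rewrite mulr_sumr; apply: eq_bigr => m _.
rewrite RintegralZl//; last exact: continuous_integrable_oo.
rewrite Wallis_even /lauricella_term -/(M m).
under [in LHS]eq_bigr do rewrite hbeta.
rewrite /C big_split/= /invsqrt_coef big_split/= prodfV.
have p0 : (pi : R) != 0 by rewrite gt_eqF// pi_gt0.
have f0 : pochhammer (1 : R) (M m) != 0.
  by rewrite pochhammer1 pnatr_eq0 -lt0n fact_gt0.
have g0 : \prod_(j < n) ((m j)`!%:R : R) != 0.
  by apply/prodf_neq0 => j _; rewrite pnatr_eq0 -lt0n fact_gt0.
by move: pi p0 => p p0; field; rewrite f0 g0 p0.
Qed.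

(** Both sides are the integral over (0, pi / 2) of the product of the functions
    (1 - x_j sin^2 t)^(-1/2): the integral by substitution, the series because
    the partial sums of the factors are bounded by the geometric series. *)
Lemma lauricella_series_half (R : realType) (n : nat) (beta x : n.-tuple R) :
  (forall j, tnth beta j = 1 / 2) -> (forall j, `|tnth x j| < 1) ->
  lauricella_series (1 / 2) beta 1 x =
  pi^-1 * \int[@lebesgue_measure R]_(u in `]0, 1[) half_integrand x u.
Proof.
move=> hbeta hx.
have x1 j : tnth x j < 1 by exact: le_lt_trans (ler_norm _) (hx j).
pose f (t : R) := \prod_(j < n) (Num.sqrt (1 - tnth x j * sin t ^+ 2))^-1.
pose P N (t : R) := \prod_(j < n) invsqrt_sum N (tnth x j * sin t ^+ 2).
pose B := \prod_(j < n) (1 - `|tnth x j|)^-1.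
have sx j t : `|tnth x j * sin t ^+ 2| <= `|tnth x j|.
  rewrite normrM ler_piMr// ger0_norm ?sqr_ge0//; exact: sqr_sin_le1.
have sx1 j t : `|tnth x j * sin t ^+ 2| < 1.
  exact: le_lt_trans (sx j t) (hx j).
have cf : continuous f.
  move=> t; apply: cvg_bigprod => j.
  apply: (@continuous_invsqrt _ (fun t => 1 - tnth x j * sin t ^+ 2)).
    by rewrite subr_gt0 (le_lt_trans (ler_norm _) (sx1 j t)).
  exact: is_derive_continuous.
have cX j k : continuous (fun t : R => (tnth x j * sin t ^+ 2) ^+ k).
  by move=> t; apply: is_derive_continuous; exact: is_derive_funX.
have cP N : continuous (P N).
  move=> t; apply: cvg_bigprod => j; apply: continuous_bigsum => k {}t.
  apply: cvgM; first exact: cvg_cst.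
  exact: cX.
have lim : (\int[@lebesgue_measure R]_(t in `]0%R, (pi / 2)%R[) (P N t)%:E)%E
      @[N --> \oo] -->
    (\int[@lebesgue_measure R]_(t in `]0%R, (pi / 2)%R[) (f t)%:E)%E.
  apply: (@dominated_cvg _ _ _ _ _ _ _ _ (fun=> B%:E)) => //.
  - move=> N; apply/measurable_EFinP; apply: measurable_funTS.
    exact: continuous_measurable_fun.
  - move=> t _; apply: cvg_EFin; first exact: nearW.
    by apply: cvg_bigprod => j; exact: invsqrt_sum_cvg.
  - by apply: continuous_integrable_oo => t; exact: cvg_cst.
  - move=> N t _; rewrite lee_fin normr_prod; apply: ler_prod => j _.
    rewrite normr_ge0/=; apply: (le_trans (invsqrt_sum_bound _ (sx1 j t))).
    by rewrite lef_pV2 ?posrE ?subr_gt0// lerD2l lerN2.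
have fi : (@lebesgue_measure R).-integrable `]0, pi / 2[ (EFin \o f).
  exact: continuous_integrable_oo.
rewrite /lauricella_series.
rewrite (_ : (fun N : nat => _) = fun N => 2 / pi *
  \int[@lebesgue_measure R]_(t in `]0, pi / 2[) P N t); last first.
  by apply/funext => N; exact: lauricella_cube_sum.
have -> : \int[@lebesgue_measure R]_(u in `]0, 1[) half_integrand x u =
    2 * \int[@lebesgue_measure R]_(t in `]0, pi / 2[) f t.
  by rewrite -RintegralZl// /Rintegral half_integrand_trig.
rewrite mulrCA mulrA.
apply/cvg_lim => //; apply: cvgM; first exact: cvg_cst.
apply: fine_cvg; rewrite fineK//; exact: integrable_fin_num.
Qed.

(** * Reduction of the genus 2 integral *)

Section reduction.
Variables (R : realType) (a b : R).
Hypotheses (ha : 1 < a) (hab : a < b).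

Let X : 3.-tuple R := [tuple 1 - a ^+ 4;
  (1 - a ^+ 4) * b ^+ 2 / (b ^+ 2 - a ^+ 2);
  (a ^+ 4 - 1) / (a ^+ 2 * b ^+ 2 - 1)].
Let k : R := b * (a ^+ 2 - 1) / (a * (b ^+ 2 - 1)).
Let D : R := (b ^+ 2 - a ^+ 2) * (a ^+ 2 * b ^+ 2 - 1).
Let C : R := 2 * Num.sqrt D / (a ^+ 3 * (b ^+ 2 - 1)).
Let K x : R := (Num.sqrt ((1 - x ^+ 2) * (1 - k ^+ 2 * x ^+ 2)))^-1.

Let a_gt0 : 0 < a. Proof. exact: lt_trans ha. Qed.
Let b_gt0 : 0 < b. Proof. exact: lt_trans hab. Qed.
Let a2 : 0 < a ^+ 2 - 1. Proof. by rewrite subr_gt0 exprn_egt1. Qed.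
Let a4 : 0 < a ^+ 4 - 1. Proof. by rewrite subr_gt0 exprn_egt1. Qed.
Let b1 : 1 < b. Proof. exact: lt_trans hab. Qed.
Let b2 : 0 < b ^+ 2 - 1. Proof. by rewrite subr_gt0 exprn_egt1. Qed.
Let b2a2 : 0 < b ^+ 2 - a ^+ 2.
Proof. by rewrite subr_gt0 ltrXn2r ?nnegrE ?ltW. Qed.
Let ab2 : 0 < a ^+ 2 * b ^+ 2 - 1.
Proof. by rewrite subr_gt0 mulr_egt1// exprn_egt1. Qed.

Let D_gt0 : 0 < D. Proof. exact: mulr_gt0. Qed.

Let k2_lt1 : k ^+ 2 < 1.
Proof.
have k0 : 0 <= k by rewrite divr_ge0 ?mulr_ge0 ?ltW.
rewrite expr_lt1// ltr_pdivrMr ?mulr_gt0// mul1r.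
have -> : b * (a ^+ 2 - 1) = a * (b ^+ 2 - 1) - (b - a) * (a * b + 1) by ring.
by rewrite gtrBl mulr_gt0 ?subr_gt0// addr_gt0// mulr_gt0.
Qed.

Let X_lt1 j : tnth X j < 1.
Proof.
move: j => [[|[|[|//]]] ?]; rewrite (tnth_nth 0)/=.
- by rewrite gtrBl (lt_trans ltr01)// exprn_egt1.
- rewrite ltr_pdivrMr// mul1r; apply: lt_trans b2a2.
  by rewrite pmulr_llt0 ?exprn_gt0// -opprB oppr_lt0.
- rewrite ltr_pdivrMr// mul1r ltrD2r.
  by rewrite -[4%N]/(2 + 2)%N exprD ltr_pM2l ?exprn_gt0// -subr_gt0.
Qed.

(** Up to powers of r, the factors become functions of r - 1 / r because
    (a^2 r^2 - 1) (a^2 - r^2) = a^2 r^2 ((a - 1/a)^2 - (r - 1/r)^2) and likewise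
    for b, while 1 - x_1 u = a^2 r^2; the modulus k is (a - 1/a) / (b - 1/b). *)
Lemma half_integrand_param (r : R) : a^-1 < r -> r < a ->
  half_integrand X ((a ^+ 2 * r ^+ 2 - 1) / (a ^+ 4 - 1)) =
  Num.sqrt D * (a ^+ 4 - 1) / (a ^+ 5 * (b ^+ 2 - 1) * (a - a^-1) * r ^+ 3) *
  K ((r - r^-1) / (a - a^-1)).
Proof.
move=> ar ra; have r0 : 0 < r by apply: lt_trans ar; rewrite invr_gt0.
have al : 0 < a - a^-1 by rewrite subr_gt0 (lt_trans _ ha)// invf_lt1.
set u := _ / (a ^+ 4 - 1); set x := _ / (a - a^-1).
have ar1 : 0 < a ^+ 2 * r ^+ 2 - 1.
  by rewrite subr_gt0 -exprMn exprn_egt1// -(@ltr_pdivrMl _ a)// mulr1.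
have br1 : 0 < b ^+ 2 * r ^+ 2 - 1.
  apply: (lt_trans ar1); rewrite ltrD2r ltr_pM2r ?exprn_gt0//.
  by rewrite -subr_gt0.
have a2r2 : 0 < a ^+ 2 - r ^+ 2 by rewrite subr_gt0 ltrXn2r ?nnegrE ?ltW.
have b2r2 : 0 < b ^+ 2 - r ^+ 2.
  by apply: (lt_trans a2r2); rewrite ltrD2r -subr_gt0.
have E1 : 1 - (1 - a ^+ 4) * u = a ^+ 2 * r ^+ 2.
  by rewrite /u; field; rewrite gt_eqF.
have E2 : 1 - (1 - a ^+ 4) * b ^+ 2 / (b ^+ 2 - a ^+ 2) * u =
    a ^+ 2 * (b ^+ 2 * r ^+ 2 - 1) / (b ^+ 2 - a ^+ 2).
  by rewrite /u; field; rewrite !gt_eqF.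
have E3 : 1 - (a ^+ 4 - 1) / (a ^+ 2 * b ^+ 2 - 1) * u =
    a ^+ 2 * (b ^+ 2 - r ^+ 2) / (a ^+ 2 * b ^+ 2 - 1).
  by rewrite /u; field; rewrite exprMn !gt_eqF.
have E0 : u * (1 - u) = a ^+ 2 * (a ^+ 2 * r ^+ 2 - 1) * (a ^+ 2 - r ^+ 2) /
    (a ^+ 4 - 1) ^+ 2.
  by rewrite /u; field; rewrite !gt_eqF.
rewrite /half_integrand.
rewrite !big_ord_recl big_ord0 mulr1 !(tnth_nth 0)/=.
rewrite E0 E1 E2 E3 /K.
have xE : (1 - x ^+ 2) = (a ^+ 2 * r ^+ 2 - 1) * (a ^+ 2 - r ^+ 2) /
    (a ^+ 2 * r ^+ 2 * (a - a^-1) ^+ 2).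
  by rewrite /x; field; rewrite !gt_eqF.
have kE : 1 - k ^+ 2 * x ^+ 2 = (b ^+ 2 * r ^+ 2 - 1) * (b ^+ 2 - r ^+ 2) /
    (r ^+ 2 * (b ^+ 2 - 1) ^+ 2).
  by rewrite /x /k; field; rewrite !gt_eqF.
have p1 : 0 < 1 - x ^+ 2 by rewrite xE divr_gt0 ?mulr_gt0 ?exprn_gt0.
have p2 : 0 < 1 - k ^+ 2 * x ^+ 2.
  by rewrite kE divr_gt0 ?mulr_gt0 ?exprn_gt0.
set Q := a ^+ 5 * (b ^+ 2 - 1) * (a - a^-1) * r ^+ 3.
have Q0 : 0 < Q by rewrite /Q !mulr_gt0 ?exprn_gt0.
have S0 : 0 < Num.sqrt ((1 - x ^+ 2) * (1 - k ^+ 2 * x ^+ 2)).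
  by rewrite sqrtr_gt0 mulr_gt0.
rewrite -!invfM -!sqrtrM ?divr_ge0 ?mulr_ge0 ?sqr_ge0 ?ltW//.
(* P collects the five factors under one root; up to squares it is
   (1 - x ^ 2) (1 - k ^ 2 x ^ 2) / D. *)
set P := (X in Num.sqrt X).
have P0 : 0 < P.
  by rewrite /P; do !apply: mulr_gt0 => //; rewrite ?invr_gt0 ?exprn_gt0.
have sqK (z : R) : 0 < z -> z = Num.sqrt (z ^+ 2).
  by move=> /gtr0_norm; rewrite sqrtr_sqr.
have M0 : Num.sqrt D * (a ^+ 4 - 1) != 0.
  by rewrite gt_eqF// mulr_gt0// sqrtr_gt0.
have PE : Num.sqrt P * (Num.sqrt D * (a ^+ 4 - 1)) =
    Q * Num.sqrt ((1 - x ^+ 2) * (1 - k ^+ 2 * x ^+ 2)).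
  rewrite (sqK _ a4) (sqK _ Q0) -!sqrtrM ?sqr_ge0 ?(ltW D_gt0) ?(ltW P0)//.
  congr Num.sqrt; rewrite xE kE /P /D /Q; field.
  by rewrite ?exprMn !gt_eqF.
by rewrite -mulrA -invfM -PE invfM mulrCA divff ?mulr1.
Qed.

Let al_gt0 : 0 < a - a^-1.
Proof. by rewrite subr_gt0 (lt_trans _ ha)// invf_lt1. Qed.

Let ln_a : 0 < ln a. Proof. exact: ln_gt0. Qed.

(** u and x as functions of s = ln r. *)
Let U (s : R) : R := (a ^+ 2 * expR s ^+ 2 - 1) / (a ^+ 4 - 1).
Let U' (s : R) : R := 2 * a ^+ 2 * expR s ^+ 2 / (a ^+ 4 - 1).
Let V (s : R) : R := (expR s - expR (- s)) / (a - a^-1).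
Let V' (s : R) : R := (expR s + expR (- s)) / (a - a^-1).

Let dU (s : R) : is_derive s 1 U (U' s).
Proof.
by apply: is_derive_eq; rewrite /U' /GRing.scale/=; field; rewrite gt_eqF.
Qed.

Let dV (s : R) : is_derive s 1 V (V' s).
Proof.
by apply: is_derive_eq; rewrite /V' /GRing.scale/=; field; rewrite !gt_eqF.
Qed.

Let cU' : continuous U'.
Proof. by move=> s; exact: is_derive_continuous. Qed.

Let cV' : continuous V'.
Proof. by move=> s; exact: is_derive_continuous. Qed.

Let U0 : U (- ln a) = 0.
Proof.
rewrite /U expRN lnK ?posrE// exprVn divff ?subrr ?mul0r//.
by rewrite gt_eqF// exprn_gt0.
Qed.

Let U1 : U (ln a) = 1.
Proof. by rewrite /U lnK ?posrE// -exprD divff// gt_eqF. Qed.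

Let V0 : V 0 = 0. Proof. by rewrite /V oppr0 subrr mul0r. Qed.

Let V1 : V (ln a) = 1.
Proof. by rewrite /V expRN lnK ?posrE// divff// gt_eqF. Qed.

Let U'_gt0 s : 0 < U' s.
Proof. by rewrite divr_gt0// !mulr_gt0// ?exprn_gt0// expR_gt0. Qed.

Let V'_gt0 s : 0 < V' s.
Proof. by rewrite divr_gt0// addr_gt0// expR_gt0. Qed.

Let K_ge0 x : 0 <= K x. Proof. by rewrite invr_ge0 sqrtr_ge0. Qed.

Let cK x : 0 < x < 1 -> {for x, continuous K}.
Proof.
move=> /andP[x0 x1].
apply: (@continuous_invsqrt _ (fun x => (1 - x ^+ 2) * (1 - k ^+ 2 * x ^+ 2))).
  have x2 : x ^+ 2 < 1 by rewrite expr_lt1// ltW.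
  rewrite mulr_gt0 ?subr_gt0// (le_lt_trans _ k2_lt1)//.
  by rewrite ler_piMr ?sqr_ge0// ltW.
exact: is_derive_continuous.
Qed.

Let h (s : R) : R := half_integrand X (U s) * U' s.

Let hE s : s \in `]- ln a, ln a[%R ->
  h s = C * (expR (- s) / (a - a^-1)) * K (V s).
Proof.
rewrite in_itv/= => /andP[s0 s1].
rewrite /h /U half_integrand_param; first last.
- by rewrite -[ltRHS](lnK (x := a)) ?posrE// ltr_expR.
- by rewrite -[ltLHS](lnK (x := a^-1)) ?posrE ?invr_gt0// lnV ?posrE// ltr_expR.
rewrite -expRN -/(V s) /U' /C expRN.
have e0 : expR s != 0 by rewrite gt_eqF// expR_gt0.
have al0 : a * a - 1 != 0 by rewrite -expr2 gt_eqF.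
by field; rewrite ?e0 ?al0 !gt_eqF.
Qed.

(** The square roots in K (V s) are even in s, so only e^-s is symmetrized. *)
Let h_sym s : s \in `]0, ln a[%R -> h s + h (- s) = C * (K (V s) * V' s).
Proof.
rewrite in_itv/= => /andP[s0 s1].
rewrite !hE ?in_itv/= ?ltrN2 ?s1 ?andbT//; last 2 first.
- by rewrite ltrNl (lt_trans _ s0)// oppr_lt0.
- by rewrite (lt_trans _ s0)// oppr_lt0.
have -> : V (- s) = - V s by rewrite /V opprK -mulNr opprB.
have -> : K (- V s) = K (V s) by rewrite /K sqrrN.
by rewrite opprK /V'; ring.
Qed.

Lemma half_integrand_reduction :
  (\int[@lebesgue_measure R]_(u in `]0%R, 1%R[) (half_integrand X u)%:E =
   C%:E * \int[@lebesgue_measure R]_(x in `]0%R, 1%R[) (K x)%:E)%E.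
Proof.
have C0 : 0 <= C by rewrite divr_ge0 ?mulr_ge0 ?exprn_ge0 ?sqrtr_ge0 ?ltW.
have la : - ln a < ln a by rewrite (@lt_trans _ _ 0)// oppr_lt0.
have := @ge0_integral_change_of_variables_oo _ U U' (half_integrand X)
  _ _ la dU.
rewrite U0 U1 => -> //; last 2 first.
- by move=> u; rewrite in_itv/= => u01; exact: continuous_half_integrand.
- by move=> u _; exact: half_integrand_ge0.
have U01 s : s \in `](- ln a), ln a[%R -> 0 < U s < 1.
  move=> sa; have : `]0, 1[ (U s).
    rewrite -U0 -U1 -(@increasing_image_itvoo _ U U' _ _ la dU) => [|t _//].
    by exists s.
  by rewrite /= in_itv.
have mh : measurable_fun `]- ln a, ln a[ h.
  apply: subspace_continuous_measurable_fun => //.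
  apply: continuous_in_subspaceT => s /[!inE] sa.
  apply: cvgM; last exact: cU'.
  apply: continuous_comp; first exact: is_derive_continuous (dU s).
  exact: continuous_half_integrand (U01 _ sa) X_lt1.
rewrite ge0_integral_even_oo//; last first.
  by move=> s _; rewrite mulr_ge0 ?half_integrand_ge0 ?ltW.
transitivity (\int[@lebesgue_measure R]_(s in `]0%R, (ln a)%R[)
    (C%:E * (K (V s) * V' s)%:E))%E.
  by apply: eq_integral => s /[!inE] sa; rewrite -EFinM -h_sym.
have := @ge0_integral_change_of_variables_oo _ V V' K _ _ ln_a dV.
rewrite V0 V1 => -> //.
have V01 s : s \in `]0, ln a[%R -> 0 < V s < 1.
  move=> sa; have : `]0, 1[ (V s).
    rewrite -V0 -V1 -(@increasing_image_itvoo _ V V' _ _ ln_a dV) => [|t _//].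
    by exists s.
  by rewrite /= in_itv.
rewrite ge0_integralZl//.
- apply/measurable_EFinP; apply: subspace_continuous_measurable_fun => //.
  apply: continuous_in_subspaceT => s /[!inE] sa.
  apply: cvgM; last exact: cV'.
  apply: continuous_comp; first exact: is_derive_continuous (dV s).
  exact: cK (V01 _ sa).
- by move=> s _; rewrite lee_fin mulr_ge0 ?K_ge0 ?(ltW (V'_gt0 _)).
Qed.

Lemma lauricellaFD_ellipticK :
  lauricellaFD (1 / 2) [tuple 1 / 2; 1 / 2; 1 / 2] 1 X =
  pi^-1 * (C * ellipticK k).
Proof.
have hbeta j : tnth [tuple 1 / 2; 1 / 2; 1 / 2 : R] j = 1 / 2.
  by move: j => [[|[|[|//]]] ?]; rewrite (tnth_nth 0).
transitivity (pi^-1 *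
    \int[@lebesgue_measure R]_(u in `]0, 1[) half_integrand X u).
  rewrite /lauricellaFD; case: ifPn => [/forallP X1|_].
    exact: lauricella_series_half.
  exact: lauricella_integral_half.
have [_ Kfin] := ellipticK_gt0_fin k2_lt1.
by rewrite /Rintegral half_integrand_reduction /K Kfin.
Qed.

Lemma pi_ellipticK_lauricellaFD :
  pi = C * (ellipticK k / lauricellaFD (1 / 2) [tuple 1 / 2; 1 / 2; 1 / 2] 1 X).
Proof.
have [K0 _] := ellipticK_gt0_fin k2_lt1.
have C0 : 0 < C by rewrite divr_gt0 ?mulr_gt0 ?exprn_gt0 ?sqrtr_gt0.
rewrite lauricellaFD_ellipticK mulrA invfM invrK invfM.
by rewrite -mulrA; move: (pi_gt0 R); move: pi => p p0; field; rewrite !gt_eqF.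
Qed.
End reduction.

Theorem theorem3p5 (R : realType) (a b : R) (ha : 1 < a) (hab : a < b) :
  pi = 2 * Num.sqrt ((b ^+ 2 - a ^+ 2) * (a ^+ 2 * b ^+ 2 - 1))
         / (a ^+ 3 * (b ^+ 2 - 1))
       * (ellipticK (b * (a ^+ 2 - 1) / (a * (b ^+ 2 - 1)))
          / lauricellaFD (1 / 2) [tuple 1 / 2; 1 / 2; 1 / 2] 1
              [tuple 1 - a ^+ 4;
                     (1 - a ^+ 4) * b ^+ 2 / (b ^+ 2 - a ^+ 2);
                     (a ^+ 4 - 1) / (a ^+ 2 * b ^+ 2 - 1)]).
Proof. exact: pi_ellipticK_lauricellaFD. Qed.
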